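(* Let $\mathcal{M},\mathcal{N}\subset\mathbb{R}^n$ be two manifolds that are $\mathcal{C}^k$-smooth ($k\geq 2$) around a point $\bar{x}\in\mathcal{M}\cap\mathcal{N}$, such that $\mathcal{M}\cap\mathcal{N}$ is a $\mathcal{C}^k$-smooth manifold around $\bar{x}$ and $\mathrm{T}_{\mathcal{M}\cap\mathcal{N}}(\bar{x})=\mathrm{T}_{\mathcal{M}}(\bar{x})\cap\mathrm{T}_{\mathcal{N}}(\bar{x})$. Let $S=(1-\alpha)I+\alpha\,\Pi^{\alpha_2}_{\mathcal{M}}\Pi^{\alpha_1}_{\mathcal{N}}$ be the generalized alternating projections operator with parameters satisfying $\alpha\in(0,1]$, $\alpha_1,\alpha_2\in(0,2]$ and either (B1) $\alpha_1,\alpha_2\in(0,2)$, or (B2) $\alpha\in(0,1)$ with $\alpha_1\neq 2$ or $\alpha_2\neq 2$. Then 1. for all $c>\|S_{\mathrm{T}(\bar{x})}-\Pi_{\mathrm{T}_{\mathcal{M}}(\bar{x})\cap\mathrm{T}_{\mathcal{N}}(\bar{x})}\|$, where $S_{\mathrm{T}(\bar{x})}\coloneqq(1-\alpha)I+\alpha\,\Pi^{\alpha_2}_{\mathrm{T}_{\mathcal{M}}(\bar{x})}\Pi^{\alpha_1}_{\mathrm{T}_{\mathcal{N}}(\bar{x})}$, there exists some $\eta>0$ so that for all $x\in\mathcal{B}_\eta(\bar{x})$ \[ \|S(x)-\Pi_{\mathcal{M}\cap\mathcal{N}}(x)\|\leq c\,\|x-\Pi_{\mathcal{M}\cap\mathcal{N}}(x)\|;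 \] 2. for all $\mu_{\bar{x}}\in(\gamma(S_{\mathrm{T}(\bar{x})}),1)$ there exists $N\in\mathbb{N}$ such that for any $k\geq N$ \[ \limsup_{x\to\bar{x},\,x\notin\mathcal{M}\cap\mathcal{N}}\frac{\|S^k(x)-\Pi_{\mathcal{M}\cap\mathcal{N}}(x)\|}{\|x-\Pi_{\mathcal{M}\cap\mathcal{N}}(x)\|}\leq\mu_{\bar{x}}^k. \]
   Context: For a closed nonempty set $C$, $\Pi_C$ is the projection and $\Pi_C^{\alpha}\coloneqq(1-\alpha)I+\alpha\Pi_C$ the relaxed projection. $\mathcal{B}_\eta(\bar{x})$ is the closed ball of radius $\eta$ around $\bar{x}$. For a matrix $A$ with spectral radius at most 1, $\gamma(A)\coloneqq\max\{|\lambda|\mid\lambda\in\{0\}\cup\Lambda(A)\setminus\{1\}\}$, where $\Lambda(A)$ is the set of eigenvalues of $A$. Tangent spaces are $\mathrm{T}_{\mathcal{M}}(x)=\ker \mathrm{J}F(x)$ for a local defining function $F$. *)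

(* Defs.v *)
From HB Require Import structures.
From mathcomp Require Import all_boot all_order all_algebra.
From mathcomp Require Import all_classical all_reals all_analysis.
From mathcomp Require Import complex.
Set Implicit Arguments. Unset Strict Implicit. Unset Printing Implicit Defensive.
Import Order.TTheory GRing.Theory Num.Theory.
Import numFieldNormedType.Exports.
Local Open Scope classical_set_scope.
Local Open Scope ring_scope.

Section Defs.
Variables (R : realType) (n : nat).
Local Notation V := 'rV[R]_n.

Definition enorm (x : V) : R := Num.sqrt (\sum_(i < n) x 0 i ^+ 2).
Definition eball (c : V) (r : R) : set V := [set x | enorm (x - c) <= r].

(* (a choice of) the Euclidean projection onto C; x itself if no nearest point *)
Definition is_nearest (C : set V) (x p : V) : Prop :=
  C p /\ forall q, C q -> enorm (x - p) <= enorm (x - q).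
Definition projC (C : set V) (x : V) : V := xget x (is_nearest C x).

Definition rproj (al : R) (C : set V) (x : V) : V := (1 - al) *: x + al *: projC C x.

Definition GAP (a a1 a2 : R) (M N : set V) (x : V) : V :=
  (1 - a) *: x + a *: rproj a2 M (rproj a1 N x).

Definition unitv (i : 'I_n) : V := delta_mx 0 i.

Fixpoint Ck (m : nat) (k : nat) (U : set V) (F : V -> 'rV[R]_m) : Prop :=
  match k with
  | 0 => forall x, U x -> {for x, continuous F}
  | k'.+1 => (forall x, U x -> {for x, continuous F}) /\
             (forall x, U x -> forall i, derivable F x (unitv i)) /\
             (forall i, Ck k' U (fun x => derive F x (unitv i)))
  end.

(* Jacobian, in row-vector convention: v *m jacobian F x = JF(x) v *)
Definition jacobian (m : nat) (F : V -> 'rV[R]_m) (x : V) : 'M[R]_(n, m) :=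
  \matrix_(i, j) (derive F x (unitv i)) 0 j.

Definition local_defining_function (k : nat) (M : set V) (xb : V)
    (m : nat) (U : set V) (F : V -> 'rV[R]_m) : Prop :=
  [/\ open U, U xb, Ck k U F, row_full (jacobian F xb) &
      M `&` U = [set x | U x /\ F x = 0]].

Definition manifold_around (k : nat) (M : set V) (xb : V) : Prop :=
  exists m (U : set V) (F : V -> 'rV[R]_m), local_defining_function k M xb U F.

Definition tangent_space (M : set V) (xb : V) : set V :=
  [set v | exists m (U : set V) (F : V -> 'rV[R]_m),
     local_defining_function 1 M xb U F /\ v *m jacobian F xb = 0].

Definition opnorm (f : V -> V) : R :=
  sup [set enorm (f x) | x in [set x | enorm x <= 1]].

(* the matrix of a (linear) map, row-vector convention: x *m mx_of f = f x *)
Definition mx_of (f : V -> V) : 'M[R]_n := \matrix_(i, j) (f (unitv i)) 0 j.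

Definition gamma (A : 'M[R]_n) : R :=
  sup ([set 0] `|` [set r | exists z : R[i],
        root (char_poly (map_mx (fun r : R => (r%:C)%C) A)) z /\ z != 1 /\
        r = Num.sqrt (complex.Re z ^+ 2 + complex.Im z ^+ 2)]).

End Defs.

(* Main.v *)
(** Near [xb] a nearest-point selection onto a C^1 manifold [M] satisfies
    [Pi_M x - y = P (x - y) + o(x - y)] for [y] in [M], where [P] projects onto
    the tangent space at [xb]: chords of [M] are almost tangent, and the residual
    [x - Pi_M x] is almost normal because tangent displacements can be corrected
    back onto [M] (Lyusternik-Graves). Hence, with [p := Pi_{M cap N} x],
    [S^j x - p = S_T^j (x - p) + o(x - p)], while the tangential part of [x - p]
    is itself [o(x - p)]; this bounds the contraction factor of [S^j] by
    [|| S_T^j - Pi_T ||]. Finally [S_T^j - Pi_T = (S_T - Pi_T)^j], the spectral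
    radius of [S_T - Pi_T] is at most [gamma S_T] since the fixed points of [S_T]
    are exactly the common tangent space, and powers of a matrix are eventually
    dominated by those of any number above its spectral radius. *)
Require Import Defs.
From HB Require Import structures.
From mathcomp Require Import all_boot all_order all_algebra.
From mathcomp Require Import all_classical all_reals all_analysis.
From mathcomp Require Import complex ring lra.
Set Implicit Arguments. Unset Strict Implicit. Unset Printing Implicit Defensive.
Import Order.TTheory GRing.Theory Num.Theory.
Import numFieldNormedType.Exports.
Local Open Scope classical_set_scope.
Local Open Scope ring_scope.

(** * Euclidean norm and orthogonal projectors *)

Lemma enorm_ge0 (R : realType) n (x : 'rV[R]_n) : 0 <= enorm x.
Proof. exact: sqrtr_ge0. Qed.
#[global] Hint Extern 0 (is_true (0 <= enorm _)) => exact: enorm_ge0 : core.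

Section Euclid.
Variable R : realType.

Definition dot n (x y : 'rV[R]_n) : R := (x *m y^T) 0 0.

Section Norm.
Variable n : nat.
Implicit Types (x y z : 'rV[R]_n) (A P : 'M[R]_n).

Lemma dotE x y : dot x y = \sum_i x 0 i * y 0 i.
Proof. by rewrite /dot mxE; apply: eq_bigr => i _; rewrite mxE. Qed.

Lemma dotC x y : dot x y = dot y x.
Proof. by rewrite !dotE; apply: eq_bigr => i _; rewrite mulrC. Qed.

Lemma dotDl x y z : dot (x + y) z = dot x z + dot y z.
Proof. by rewrite /dot mulmxDl mxE. Qed.

Lemma dotDr x y z : dot z (x + y) = dot z x + dot z y.
Proof. by rewrite dotC dotDl !(dotC z). Qed.

Lemma dotZl t x y : dot (t *: x) y = t * dot x y.
Proof. by rewrite /dot -scalemxAl mxE. Qed.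

Lemma dotZr t x y : dot x (t *: y) = t * dot x y.
Proof. by rewrite dotC dotZl dotC. Qed.

Lemma dotNl x y : dot (- x) y = - dot x y.
Proof. by rewrite /dot mulNmx mxE. Qed.

Lemma dotNr x y : dot x (- y) = - dot x y.
Proof. by rewrite dotC dotNl dotC. Qed.

Lemma dot_mulmxl A x y : dot (x *m A) y = dot x (y *m A^T).
Proof. by rewrite /dot trmx_mul trmxK mulmxA. Qed.

Lemma sqr_enorm x : enorm x ^+ 2 = dot x x.
Proof.
rewrite sqr_sqrtr; last by apply: sumr_ge0 => i _; exact: sqr_ge0.
by rewrite dotE; apply: eq_bigr => i _; rewrite expr2.
Qed.

Lemma enorm0 : enorm (0 : 'rV[R]_n) = 0.
Proof.
by apply/eqP; rewrite -sqrf_eq0 sqr_enorm /dot mul0mx mxE.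
Qed.

Lemma ler_coord_enorm x i : `|x 0 i| <= enorm x.
Proof.
rewrite -ler_sqr ?nnegrE ?normr_ge0 // sqr_enorm dotE (bigD1 i) //=.
rewrite real_normK ?num_real // -expr2 lerDl.
by apply: sumr_ge0 => j _; rewrite -expr2 sqr_ge0.
Qed.

Lemma enorm_eq0 x : enorm x = 0 -> x = 0.
Proof.
move=> x0; apply/rowP => i; rewrite [RHS]mxE; apply/eqP.
by rewrite -normr_le0 -x0 ler_coord_enorm.
Qed.

Lemma enormZ t x : enorm (t *: x) = `|t| * enorm x.
Proof.
apply/eqP; rewrite -(@eqrXn2 _ 2) ?mulr_ge0 // exprMn !sqr_enorm dotZl dotZr mulrA.
by rewrite real_normK ?num_real // expr2.
Qed.

Lemma enormN x : enorm (- x) = enorm x.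
Proof. by rewrite -scaleN1r enormZ normrN1 mul1r. Qed.

Lemma enormB x y : enorm (x - y) = enorm (y - x).
Proof. by rewrite -enormN opprB. Qed.

Lemma cauchy_schwarz x y : dot x y <= enorm x * enorm y.
Proof.
have [y0|y0] := eqVneq (enorm y) 0.
  by rewrite y0 mulr0 (enorm_eq0 y0) /dot trmx0 mulmx0 mxE.
have yp : 0 < enorm y by rewrite lt_neqAle eq_sym y0 enorm_ge0.
apply: le_trans (ler_norm _) _.
rewrite -ler_sqr ?nnegrE ?normr_ge0 ?mulr_ge0 // exprMn real_normK ?num_real //.
(* Up to the factor [enorm y ^+ 2], this vector is the component of [x] orthogonal to [y]. *)
have : 0 <= enorm (enorm y ^+ 2 *: x - dot x y *: y) ^+ 2 by exact: sqr_ge0.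
rewrite sqr_enorm !(dotDl, dotDr, dotNl, dotNr, dotZl, dotZr) (dotC y x).
rewrite -!sqr_enorm.
set a := enorm x; set b := enorm y in yp *; set d := dot x y => h.
have : 0 <= b ^+ 2 * (a ^+ 2 * b ^+ 2 - d ^+ 2) by move: h; lra.
by rewrite pmulr_rge0 ?exprn_gt0 // subr_ge0.
Qed.

Lemma ler_enormD x y : enorm (x + y) <= enorm x + enorm y.
Proof.
rewrite -ler_sqr ?nnegrE ?addr_ge0 // sqrrD sqr_enorm !(dotDl, dotDr) (dotC y x).
have := cauchy_schwarz x y; rewrite -!sqr_enorm; lra.
Qed.

Lemma ler_enormB x y : enorm (x - y) <= enorm x + enorm y.
Proof. by rewrite -(enormN y) ler_enormD. Qed.

Lemma enorm_dist_triangle y x z : enorm (x - z) <= enorm (x - y) + enorm (y - z).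
Proof. by rewrite -[x - z](subrKA y) ler_enormD. Qed.

Lemma ler_enorm_sum (I : Type) (r : seq I) (F : I -> 'rV[R]_n) :
  enorm (\sum_(i <- r) F i) <= \sum_(i <- r) enorm (F i).
Proof.
elim/big_ind2: _ => [|x a y b xa yb|//]; first by rewrite enorm0.
exact: le_trans (ler_enormD _ _) (lerD xa yb).
Qed.

Lemma ler_norm_enorm x : `|x| <= enorm x.
Proof.
rewrite [leLHS]/Num.Def.normr /= mx_normrE; apply: bigmax_le => // -[i j] _.
by rewrite ord1 ler_coord_enorm.
Qed.

Lemma ler_coord_norm x i : `|x 0 i| <= `|x|.
Proof.
rewrite [leRHS]/Num.Def.normr /= mx_normrE.
by apply/bigmax_geP; right; exists (0, i).
Qed.

Lemma enorm_unitv (i : 'I_n) : enorm (unitv R i) = 1.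
Proof.
apply/eqP; rewrite -(@eqrXn2 _ 2) // expr1n sqr_enorm dotE (bigD1 i) //=.
rewrite !mxE !eqxx mul1r big1 ?addr0 // => j ji.
by rewrite !mxE eqxx (negPf ji) mul0r.
Qed.

Lemma row_sum_unitv x : x = \sum_i x 0 i *: unitv R i.
Proof. exact: row_sum_delta. Qed.

Lemma ler_enorm_norm x : enorm x <= n%:R * `|x|.
Proof.
rewrite {1}(row_sum_unitv x); apply: le_trans (ler_enorm_sum _ _) _.
apply: (@le_trans _ _ (\sum_(i < n) `|x|)).
  apply: ler_sum => i _.
  by rewrite enormZ enorm_unitv mulr1 ler_coord_norm.
by rewrite sumr_const card_ord mulr_natl.
Qed.

End Norm.

Lemma mulmx_bounded n m (A : 'M[R]_(n, m)) :
  exists2 K, 0 < K & forall x : 'rV_n, enorm (x *m A) <= K * enorm x.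
Proof.
exists (1 + \sum_i enorm (unitv R i *m A)).
  by rewrite ltr_pwDl // sumr_ge0.
move=> x; rewrite {1}(row_sum_unitv x) mulmx_suml.
apply: le_trans (ler_enorm_sum _ _) _.
rewrite mulrDl mul1r mulr_suml; apply: ler_wpDl => //; apply: ler_sum => i _.
by rewrite -scalemxAl enormZ mulrC ler_wpM2l // ler_coord_enorm.
Qed.

(** Symmetric idempotents are the orthogonal projectors; the subspace is encoded as the set of row
    vectors that [P] fixes. *)
Definition orthoproj n (P : 'M[R]_n) := P^T = P /\ P *m P = P.

Section Orthoproj.
Variables (n : nat) (P : 'M[R]_n).
Hypothesis Pproj : orthoproj P.
Implicit Type x : 'rV[R]_n.

Lemma dot_orthoproj x y : dot (x *m P) (y - y *m P) = 0.
Proof.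
have [Ps Pi] := Pproj.
by rewrite dot_mulmxl Ps mulmxBl -mulmxA Pi subrr /dot trmx0 mulmx0 mxE.
Qed.

Lemma pythagoras x y :
  enorm (x - y *m P) ^+ 2 =
  enorm (x - x *m P) ^+ 2 + enorm (x *m P - y *m P) ^+ 2.
Proof.
rewrite -[x - y *m P](subrKA (x *m P)) -mulmxBl.
have := dot_orthoproj (x - y) x.
move: (x - x *m P) ((x - y) *m P) => u v vu.
by rewrite !sqr_enorm dotDl !dotDr vu (dotC u v) vu addr0 add0r.
Qed.

Lemma pythagoras0 x : enorm x ^+ 2 = enorm (x - x *m P) ^+ 2 + enorm (x *m P) ^+ 2.
Proof. by have := pythagoras x 0; rewrite mul0mx !subr0. Qed.

(** By Pythagoras [x *m P] is the only nearest point, so the choice made by [projC] is forced. *)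
Lemma projC_orthoproj x : projC [set v | v *m P = v] x = x *m P.
Proof.
have [_ Pi] := Pproj.
apply: xget_unique => [|q [/= qP qmin]].
  split=> /= [|q qP]; first by rewrite -mulmxA Pi.
  by rewrite -ler_sqr ?nnegrE // -qP (pythagoras x q) lerDl sqr_ge0.
have := qmin (x *m P); rewrite /= -mulmxA Pi => /(_ erefl).
rewrite -ler_sqr ?nnegrE // -qP (pythagoras x q) gerDl => le0.
have /eqP : enorm (x *m P - q *m P) ^+ 2 == 0 by rewrite eq_le le0 sqr_ge0.
by move/eqP; rewrite sqrf_eq0 => /eqP /enorm_eq0 /eqP; rewrite subr_eq0 => /eqP.
Qed.

End Orthoproj.

End Euclid.

(** * Strict differentiability of C^1 maps *)

Section StrictDifferentiability.
Variables (R : realType) (n : nat).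

(** Both end points are free, unlike in differentiability at [xb]: chords of a manifold and Newton
    steps need not start at [xb]. *)
Definition strict_diff m (F : 'rV[R]_n -> 'rV[R]_m) xb (J : 'M[R]_(n, m)) :=
  forall e : R, 0 < e -> exists2 d : R, 0 < d &
    forall z w, enorm (z - xb) <= d -> enorm (w - xb) <= d ->
      enorm (F z - F w - (z - w) *m J) <= e * enorm (z - w).

Lemma is_derive_along (f : 'rV[R]_n -> R) (w v : 'rV[R]_n) (t : R) :
  derivable f (w + t *: v) v ->
  is_derive t 1 (fun s : R => f (w + s *: v)) ('D_v f (w + t *: v)).
Proof.
move=> fd.
have E : (fun h : R => h^-1 *: (((fun s : R => f (w + s *: v)) \o shift t) (h *: 1)
            - f (w + t *: v))) =
         (fun h : R => h^-1 *: ((f \o shift (w + t *: v)) (h *: v) - f (w + t *: v))).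
  apply/funext => h /=; congr (_ *: (f _ - _)).
  by rewrite [h *: 1]mulr1 scalerDl addrCA.
by split; [rewrite /derivable E | rewrite /derive E].
Qed.

(** The mean value theorem applies to each coordinate of [F] separately, whence the sup norm. *)
Lemma partial_increment m (F : 'rV[R]_n -> 'rV[R]_m) (w v : 'rV[R]_n)
    (D : 'rV[R]_m) (s e : R) :
  (forall t, `|t| <= `|s| -> derivable F (w + t *: v) v /\
                             `|'D_v F (w + t *: v) - D| <= e) ->
  `|F (w + s *: v) - F w - s *: D| <= e * `|s|.
Proof.
move=> H.
have e0 : 0 <= e.
  by have [|_] := H 0; [rewrite normr0 | apply: le_trans].
rewrite [leLHS]/Num.Def.normr /= mx_normrE.
apply: bigmax_le => [|[i j] _ /=]; first by rewrite mulr_ge0.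
rewrite ord1 !mxE.
pose f x : R := F x 0 j; pose g (t : R) : R := f (w + t *: v).
have fd (t : R) : `|t| <= `|s| -> is_derive t 1 g ('D_v f (w + t *: v)).
  by move=> /H[/derivable_mxP /(_ 0 j) /is_derive_along].
have fe (t : R) : `|t| <= `|s| -> `|'D_v f (w + t *: v) - D 0 j| <= e.
  move=> /H[dF]; apply: le_trans; rewrite derive_mx //.
  by apply: le_trans (ler_coord_norm _ j); rewrite !mxE.
have gc (t : R) : `|t| <= `|s| -> {for t, continuous g}.
  move=> /fd dg; apply: differentiable_continuous.
  by apply/derivable1_diffP; case: dg.
have mvt a b : a <= b -> (forall t, t \in `[a, b] -> `|t| <= `|s|) ->
    `|g b - g a - (b - a) * D 0 j| <= e * (b - a).
  move=> ab abs.
  have [||c cab ->] := @MVT_segment _ g (fun t => 'D_v f (w + t *: v)) a b ab.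
  - by move=> t /subset_itv_oo_cc /abs /fd.
  - apply: continuous_in_subspaceT => t /set_mem /abs ts; exact: gc.
  rewrite mulrC -mulrBr normrM ger0_norm ?subr_ge0 // mulrC.
  by rewrite ler_wpM2r ?subr_ge0 // fe // abs.
have -> : F w 0 j = g 0 by rewrite /g /f scale0r addr0.
have -> : F (w + s *: v) 0 j = g s by [].
have [s0|s0] := leP 0 s.
  have : `|g s - g 0 - (s - 0) * D 0 j| <= e * (s - 0).
    apply: (mvt 0 s s0) => t; rewrite in_itv /= => /andP[t0 ts].
    by rewrite !ger0_norm.
  by rewrite subr0 (ger0_norm s0).
have : `|g 0 - g s - (0 - s) * D 0 j| <= e * (0 - s).
  apply: (mvt s 0 (ltW s0)) => t; rewrite in_itv /= => /andP[st t0].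
  by rewrite (ler0_norm t0) (ltr0_norm s0) lerN2.
rewrite sub0r (ltr0_norm s0) -normrN; congr (`|_| <= _); ring.
Qed.

(* Going from [w] to [z] one coordinate at a time never leaves the sup-norm
   ball around [xb], so the partial derivatives stay close to those at [xb]. *)
Lemma Ck1_strict_diff m (U : set 'rV[R]_n) (F : 'rV[R]_n -> 'rV[R]_m) xb :
  open U -> U xb -> Ck 1 U F -> strict_diff F xb (Defs.jacobian F xb).
Proof.
move=> oU Uxb [_ [dF cF]] e e0.
(* There are [n] coordinate steps, and each loses a factor [m] in passing from the sup norm to the
   Euclidean one; the 1 keeps [N] positive. *)
pose N : R := (n * m)%:R + 1.
have N0 : 0 < N by rewrite ltr_wpDl.
pose e' := e / N; have e'0 : 0 < e' by rewrite divr_gt0.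
have : \forall x \near xb, U x /\
    forall i, `|'D_(unitv R i) F x - 'D_(unitv R i) F xb| <= e'.
  have near_partials : \forall x \near xb,
      forall i, `|'D_(unitv R i) F x - 'D_(unitv R i) F xb| <= e'.
    apply: (filter_forall (nbhs_filter xb)) => i.
    move: (cF i xb Uxb) => /cvgrPdist_le /(_ _ e'0).
    by apply: filterS => x; rewrite distrC.
  by apply: filterI near_partials; exact: open_nbhs_nbhs.
move=> /nbhs_ballP[d /= d0 Hd].
have {}Hd (x : 'rV[R]_n) : (forall i, `|x 0 i - xb 0 i| < d) -> U x /\
    forall i, `|'D_(unitv R i) F x - 'D_(unitv R i) F xb| <= e'.
  move=> xd; apply: Hd; split=> // i j.
  by rewrite ord1 /ball /= distrC.
(* Each coordinate of an intermediate point is off by at most [|w - xb| + |z - w|], hence by three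
   quarters of [d]. *)
exists (d / 4); first by rewrite divr_gt0.
move=> z w zd wd.
have zi i : `|z 0 i - xb 0 i| < d.
  have := ler_coord_enorm (z - xb) i; rewrite !mxE; lra.
have wi i : `|w 0 i - xb 0 i| < d.
  have := ler_coord_enorm (w - xb) i; rewrite !mxE; lra.
pose y (k : nat) : 'rV[R]_n := \row_i (if (i < k)%N then z 0 i else w 0 i).
have y0 : y 0%N = w by apply/rowP => i; rewrite mxE.
have yn : y n = z by apply/rowP => i; rewrite mxE ltn_ord.
have yS (i : 'I_n) : y i.+1 = y i + (z 0 i - w 0 i) *: unitv R i.
  apply/rowP => j; rewrite !mxE eqxx /= ltnS leq_eqVlt.
  have [->|ji] := eqVneq j i; first by rewrite ltnn eqxx /= mulr1 addrC subrK.
  by rewrite mulr0 addr0 -(inj_eq val_inj) in ji *; rewrite (negPf ji).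
have step (i : 'I_n) :
    `|F (y i.+1) - F (y i) - (z 0 i - w 0 i) *: 'D_(unitv R i) F xb|
      <= e' * `|z 0 i - w 0 i|.
  rewrite yS; apply: partial_increment => t ts.
  suff /Hd[Ux /(_ i) ?] : forall j, `|(y i + t *: unitv R i) 0 j - xb 0 j| < d.
    by split=> //; exact: dF.
  move=> j; rewrite !mxE eqxx /=.
  have [->|ji] := eqVneq j i; last by rewrite mulr0 addr0; case: ifP.
  rewrite ltnn mulr1.
  have h1 : `|w 0 i + t - xb 0 i| <= `|w 0 i - xb 0 i| + `|t|.
    by rewrite addrAC ler_normD.
  have h2 : `|z 0 i - w 0 i| <= `|z 0 i - xb 0 i| + `|w 0 i - xb 0 i|.
    by rewrite -(subrKA (xb 0 i)) (le_trans (ler_normD _ _)) // (distrC (xb 0 i)).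
  have zd' := ler_coord_enorm (z - xb) i; have wd' := ler_coord_enorm (w - xb) i.
  rewrite !mxE in zd' wd'; lra.
have -> : F z - F w - (z - w) *m Defs.jacobian F xb =
    \sum_(i < n) (F (y i.+1) - F (y i) - (z 0 i - w 0 i) *: 'D_(unitv R i) F xb).
  rewrite sumrB; congr (_ - _).
    rewrite -[in F z]yn -[in F w]y0 -(telescope_sumr (fun k => F (y k)) (leq0n n)).
    by rewrite big_mkord.
  rewrite mulmx_sum_row; apply: eq_bigr => i _; rewrite !mxE; congr (_ *: _).
  by apply/rowP => j; rewrite !mxE.
apply: le_trans (ler_enorm_sum _ _) _.
apply: (@le_trans _ _ (\sum_(i < n) m%:R * (e' * enorm (z - w)))).
  apply: ler_sum => i _; apply: le_trans (ler_enorm_norm _) _.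
  rewrite ler_wpM2l //; apply: le_trans (step i) _.
  rewrite ler_wpM2l ?(ltW e'0) //.
  by have := ler_coord_enorm (z - w) i; rewrite !mxE.
rewrite sumr_const card_ord -[_ *+ n]mulr_natl !mulrA -natrM ler_wpM2r //.
by rewrite ler_pdivrMr // mulrC ler_wpM2l ?(ltW e0) // lerDl.
Qed.

End StrictDifferentiability.

(** * Minimisers and the Lyusternik-Graves theorem *)

Section Minimisers.
Variables (R : realType) (n : nat).

(** The topology of row vectors comes from the sup norm; this transfers Euclidean Lipschitz bounds
    to it. *)
Lemma lipschitz_enorm_continuous (W : normedModType R) (f : 'rV[R]_n -> W) (K : R) :
  (forall x y, `|f x - f y| <= K * enorm (x - y)) -> continuous f.
Proof.
move=> fK x; apply/(cvgrPdist_le (FF := nbhs_filter x)) => e e0.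
pose L := (`|K| + 1) * (n%:R + 1); have L0 : 0 < L by rewrite mulr_gt0 ?ltr_wpDl.
apply/nbhs_ballP; exists (e / L); first by rewrite /= divr_gt0.
move=> y; rewrite -ball_normE /= => xy.
apply: le_trans (fK x y) _.
have xyL : L * `|x - y| <= e by rewrite mulrC -ler_pdivlMr // ltW.
apply: le_trans xyL; apply: (@le_trans _ _ (`|K| * enorm (x - y))).
  by rewrite ler_wpM2r // ler_norm.
rewrite /L -mulrA ler_pM // ?lerDl //.
by rewrite (le_trans (ler_enorm_norm _)) // ler_wpM2r // lerDl.
Qed.

Lemma enorm_continuous : continuous (@enorm R n).
Proof.
apply: (@lipschitz_enorm_continuous R^o _ 1) => x y; rewrite mul1r.
have := ler_enormD (x - y) y; have := ler_enormD (y - x) x.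
by rewrite !subrK (enormB y x) ler_norml => ? ?; apply/andP; split; lra.
Qed.

Lemma enorm_dist_continuous (c : 'rV[R]_n) :
  continuous (fun x : 'rV[R]_n => enorm (x - c)).
Proof.
move=> x; apply: continuous_comp; last exact: enorm_continuous.
by apply: continuousB => //; exact: cst_continuous.
Qed.

Lemma closed_eball (c : 'rV[R]_n) (r : R) : closed (eball c r).
Proof.
have /continuous_closedP ec := @enorm_dist_continuous c.
exact: (ec [set y | y <= r] (@closed_le _ r)).
Qed.

Lemma exists_minimiser (K : set 'rV[R]_n) (f : 'rV[R]_n -> R) c r :
  closed K -> K `<=` eball c r -> K !=set0 ->
  (forall x, K x -> {for x, continuous f}) ->
  exists2 x, K x & forall y, K y -> f x <= f y.
Proof.
move=> cK Kb K0 fc.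
have [||x xK xmin] := EVT_min_rV K0 (_ : compact K) (_ : {within K, continuous f}).
- apply: bounded_closed_compact => //.
  exists (enorm c + r); split=> [|M rM x Kx]; first exact: num_real.
  apply: le_trans (ltW rM); apply: le_trans (ler_norm_enorm _) _.
  have := Kb _ Kx; rewrite /eball /= => xr.
  by rewrite -[x](subrK c) (le_trans (ler_enormD _ _)) // addrC lerD2l.
- by apply: continuous_in_subspaceT => x /set_mem; exact: fc.
by exists x; [exact: set_mem | move=> y Ky; apply: xmin; exact: mem_set].
Qed.

(** Only points of [C] at least as close to [x] as a given [c] compete, and they form a compact
    set. *)
Lemma exists_nearest (C : set 'rV[R]_n) x :
  closed C -> C !=set0 -> is_nearest C x (projC C x).
Proof.
move=> cC [c Cc]; apply: (xgetPex x).
have [|||p [Cp pr] pmin] := @exists_minimiser (C `&` eball x (enorm (c - x)))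
    (fun y : 'rV[R]_n => enorm (y - x)) x (enorm (c - x)) _ (@subIsetr _ _ _).
- by apply: closedI => //; exact: closed_eball.
- by exists c; split => //; rewrite /eball /=.
- by move=> y _; exact: enorm_dist_continuous.
exists p; split=> // q Cq; rewrite !(enormB x).
have [qr|/ltW qr] := leP (enorm (q - x)) (enorm (c - x)); first by apply: pmin.
exact: le_trans qr.
Qed.

End Minimisers.

Section Graves.
Variables (R : realType) (n m : nat).

Lemma eball_sub_open (U : set 'rV[R]_n) xb : open U -> U xb ->
  exists2 d, 0 < d & eball xb d `<=` U.
Proof.
move=> oU Uxb; have /nbhs_ballP[d /= d0 dU] := open_nbhs_nbhs (conj oU Uxb).
exists (d / 2); first by rewrite divr_gt0.
move=> x; rewrite /eball /= => xd; apply: dU; rewrite -ball_normE /= distrC.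
by apply: le_lt_trans (ler_norm_enorm _) _; lra.
Qed.

(* The residual [enorm (F z)] plus a small multiple of the displacement is
   minimised over a compact ball; a Newton step from the minimiser would lower
   it unless [F z = 0]. *)
Lemma graves (F : 'rV[R]_n -> 'rV[R]_m) (U : set 'rV[R]_n) xb
    (J : 'M[R]_(n, m)) (B : 'M[R]_(m, n)) :
  open U -> U xb -> (forall x, U x -> {for x, continuous F}) ->
  strict_diff F xb J -> B *m J = 1%:M ->
  forall e, 0 < e -> exists2 d, 0 < d & forall q v, enorm (q - xb) <= d ->
    F q = 0 -> enorm v <= d -> v *m J = 0 ->
    exists2 q', U q' /\ F q' = 0 & enorm (q' - q - v) <= e * enorm v.
Proof.
move=> oU Uxb cF dF BJ e e0.
have [KB KB0 Bb] := mulmx_bounded B.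
(* The bound by 1 makes a Newton step cut the residual to a quarter; the bound by [e] controls the
   final correction, of size at most [2 * k * KB * enorm v]. *)
pose k := Num.min e 1 / (4 * KB).
have k0 : 0 < k by rewrite divr_gt0 ?mulr_gt0 // lt_min e0 ltr01.
have k4 : 4 * (k * KB) = Num.min e 1 by rewrite /k; field; rewrite gt_eqF.
have ke : 4 * (k * KB) <= e by rewrite k4 ge_min lexx.
have k1 : 4 * (k * KB) <= 1 by rewrite k4 ge_min lexx orbT.
clearbody k.
have [d0 d00 Hd0] := dF k k0.
have [d1 d10 Hd1] := eball_sub_open oU Uxb.
pose d := Num.min d0 d1 / 3.
have d_gt0 : 0 < d by rewrite divr_gt0 // lt_min d00.
have d3 : 3 * d = Num.min d0 d1 by rewrite /d; field.
have dd0 : 3 * d <= d0 by rewrite d3 ge_min lexx.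
have dd1 : 3 * d <= d1 by rewrite d3 ge_min lexx orbT.
clearbody d; exists d => // q v qd Fq vd vJ.
have v0 := enorm_ge0 v.
(* Corrections are sought in the range of [B], where the derivative acts as the identity on [u]
   because [B *m J = 1%:M]. *)
pose z u := q + v + u *m B.
have zq u : z u - xb = (q - xb) + v + u *m B by rewrite /z addrAC (addrAC q).
have zd u : enorm u <= 3 * k * enorm v -> enorm (z u - xb) <= 3 * d.
  move=> uv; rewrite zq; have := ler_enormD (q - xb + v) (u *m B).
  have := ler_enormD (q - xb) v; have := Bb u.
  have := ler_wpM2l (ltW KB0) uv.
  have := ler_wpM2r v0 k1; lra.
have zU u : enorm u <= 3 * k * enorm v -> U (z u).
  by move=> /zd zu; apply: Hd1; rewrite /eball /=; exact: le_trans dd1.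
pose phi u := enorm (F (z u)) + 2^-1 * enorm u.
have [||u uK umin] := @exists_minimiser R m (eball 0 (3 * k * enorm v)) phi 0
    (3 * k * enorm v) (@closed_eball _ _ _ _) (fun _ => id).
- by exists 0; rewrite /eball /= subrr enorm0 !mulr_ge0 // ltW.
- move=> u; rewrite /eball /= subr0 => uK.
  apply: (@continuousD _ _ _ (fun u => enorm (F (z u))) (fun u => 2^-1 * enorm u)).
    apply: (@continuous_comp _ _ _ (F \o z)); last exact: enorm_continuous.
    apply: continuous_comp; last by apply: cF; exact: zU.
    apply: (lipschitz_enorm_continuous (K := KB)) => y y'.
    by rewrite /z opprD addrACA subrr add0r -mulmxBl (le_trans (ler_norm_enorm _)).
  apply: continuousM; first exact: cst_continuous.
  exact: enorm_continuous.
move: uK; rewrite /eball /= subr0 => uK.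
have Fz0 : enorm (F (z 0)) <= k * enorm v.
  have z0q : z 0 - q = v by rewrite /z mul0mx addr0 addrC addKr.
  rewrite -z0q; have := Hd0 (z 0) q; rewrite z0q Fq vJ !subr0; apply.
    by apply: le_trans dd0; apply: zd; rewrite enorm0 !mulr_ge0 // ltW.
  by apply: le_trans qd _; lra.
have phi_u : phi u <= k * enorm v.
  apply: le_trans (umin 0 _) _.
    by rewrite /eball /= subrr enorm0 !mulr_ge0 // ltW.
  by rewrite /phi enorm0 mulr0 addr0.
have f0 := enorm_ge0 (F (z u)); have u0 := enorm_ge0 u.
(* The Newton step: it quarters the residual and raises [enorm u] by at most the old residual, so
   [phi] would drop by at least a quarter of that residual. Since [phi u <= k * enorm v] forces
   [enorm u <= 2 * k * enorm v], the radius [3 * k * enorm v] leaves room for [u']. *)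
pose u' := u - F (z u).
have u'K : enorm u' <= 3 * k * enorm v.
  by have := ler_enormB u (F (z u)); rewrite /phi in phi_u; rewrite -/u'; lra.
have zz : z u' - z u = - (F (z u) *m B).
  by rewrite /z /u' mulmxBl opprD addrACA subrr add0r addrC addKr.
have Fz' : enorm (F (z u')) <= 4^-1 * enorm (F (z u)).
  have := Hd0 (z u') (z u) (le_trans (zd _ u'K) dd0) (le_trans (zd _ uK) dd0).
  rewrite zz mulNmx -mulmxA BJ mulmx1 opprK subrK enormN => /le_trans; apply.
  have := ler_wpM2l (ltW k0) (Bb (F (z u))).
  have := ler_wpM2r f0 k1; lra.
have Fz : enorm (F (z u)) = 0.
  have := umin u'; rewrite /eball /= subr0 => /(_ u'K); rewrite /phi.
  have := ler_enormB u (F (z u)); rewrite -/u' => h1 h2.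
  apply/eqP; rewrite eq_le f0 andbT; lra.
exists (z u); first by split; [exact: zU | exact: enorm_eq0].
have -> : z u - q - v = u *m B by rewrite /z -(addrA q v) (addrC q) addrK [v + _]addrC addrK.
apply: le_trans (Bb u) _.
have u2 : enorm u <= 2 * k * enorm v by rewrite /phi Fz in phi_u; lra.
have := mulr_ge0 (mulr_ge0 (ltW k0) (ltW KB0)) v0.
have := ler_wpM2l (ltW KB0) u2; have := ler_wpM2r v0 ke; lra.
Qed.

End Graves.

(** * Tangent projectors *)

(** A positive [x] is refuted by a tolerance [e] not above [x / (2 * K)], which gives
    [x <= x / 2]. *)
Lemma le0_of_small (R : realType) (x K : R) :
  (forall e, 0 < e -> e <= 1 -> x <= e * K) -> x <= 0.
Proof.
move=> H; rewrite leNgt; apply/negP => x0.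
have K0 : 0 < K by have := H 1 ltr01 (lexx _); rewrite mul1r; exact: lt_le_trans.
have := H (Num.min 1 (x / (2 * K))).
rewrite lt_min ltr01 divr_gt0 ?mulr_gt0 // ge_min lexx => /(_ isT isT) h.
have : Num.min 1 (x / (2 * K)) * K <= x / (2 * K) * K.
  by rewrite ler_wpM2r ?(ltW K0) // ge_min lexx orbT.
have -> : x / (2 * K) * K = x / 2 by field; rewrite gt_eqF.
lra.
Qed.

Section TangentProjector.
Variables (R : realType) (n : nat).
Implicit Types (M : set 'rV[R]_n) (xb : 'rV[R]_n) (P Q : 'M[R]_n).

(* [P] projects onto a space that approximates [M] uniformly to first order
   near [xb]: chords of [M] are almost parallel to it, and small displacements
   along it can be corrected to stay in [M]. *)
Definition tangent_proj M xb P := [/\ orthoproj P,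
  forall e : R, 0 < e -> exists2 d : R, 0 < d & forall q y, M q -> M y ->
    enorm (q - xb) <= d -> enorm (y - xb) <= d ->
    enorm ((q - y) - (q - y) *m P) <= e * enorm (q - y) &
  forall e : R, 0 < e -> exists2 d : R, 0 < d & forall q v, M q ->
    enorm (q - xb) <= d -> enorm v <= d -> v *m P = v ->
    exists2 q', M q' & enorm (q' - q - v) <= e * enorm v].

Lemma gram_unitmx m (J : 'M[R]_(n, m)) : row_full J -> J^T *m J \in unitmx.
Proof.
move=> /row_fullP[B BJ]; rewrite -row_free_unit; apply: inj_row_free => u uJJ.
suff uJ : u *m J^T = 0.
  by rewrite -[u]mulmx1 -trmx1 -BJ trmx_mul mulmxA uJ mul0mx.
apply: enorm_eq0; apply/eqP; rewrite -sqrf_eq0 sqr_enorm /dot trmx_mul trmxK.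
by rewrite mulmxA -(mulmxA u) uJJ mul0mx mxE.
Qed.

(** [B] is the Moore-Penrose inverse of [J], so [J *m B] projects onto the normal space. The same
    [B] serves in the Newton steps of [graves]. *)
Lemma kernel_orthoproj m (J : 'M[R]_(n, m)) : row_full J ->
  exists B : 'M[R]_(m, n), [/\ B *m J = 1%:M, orthoproj (1%:M - J *m B) &
    forall v : 'rV_n, v *m (1%:M - J *m B) = v <-> v *m J = 0].
Proof.
move=> /gram_unitmx JJ; pose B := invmx (J^T *m J) *m J^T.
have BJ : B *m J = 1%:M by rewrite /B -mulmxA mulVmx.
exists B; split=> //.
  split; first by rewrite linearB /= trmx1 /B !trmx_mul trmxK trmx_inv trmx_mul trmxK mulmxA.
  rewrite mulmxBr mulmx1 mulmxBl mul1mx -mulmxA (mulmxA B) BJ mul1mx.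
  by rewrite subrr subr0.
move=> v; rewrite mulmxBr mulmx1 mulmxA; split=> [vP|->]; last by rewrite mul0mx subr0.
have : v *m J *m B *m J = 0.
  by rewrite -(subKr v (v *m J *m B)) vP subrr mul0mx.
by rewrite -mulmxA BJ mulmx1.
Qed.

(** [F] vanishes at both ends of a chord, so strict differentiability makes the image of the chord
    under the Jacobian small; [graves] supplies the corrections. *)
Lemma exists_tangent_proj M xb m U (F : 'rV[R]_n -> 'rV[R]_m) :
  local_defining_function 1 M xb U F ->
  exists2 P, tangent_proj M xb P &
    forall v : 'rV_n, v *m P = v <-> v *m Defs.jacobian F xb = 0.
Proof.
move=> [oU Uxb CF rJ MU].
have MUP q : M q -> U q -> F q = 0.
  by move=> Mq Uq; have [] : [set x | U x /\ F x = 0] q by rewrite -MU.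
have UMP q : U q -> F q = 0 -> M q.
  by move=> Uq Fq; have [] : (M `&` U) q by rewrite MU.
have dF := Ck1_strict_diff oU Uxb CF.
have [B [BJ PP kerP]] := kernel_orthoproj rJ.
exists (1%:M - Defs.jacobian F xb *m B) => //; split=> // e e0.
- have [K K0 KB] := mulmx_bounded B.
  have [d1 d10 H1] := dF (e / K) (divr_gt0 e0 K0).
  have [d2 d20 H2] := eball_sub_open oU Uxb.
  exists (Num.min d1 d2); first by rewrite lt_min d10.
  move=> q y Mq My; rewrite !le_min => /andP[q1 /H2 Uq] /andP[y1 /H2 Uy].
  have := H1 q y q1 y1; rewrite (MUP q) // (MUP y) // subr0 sub0r enormN => h.
  rewrite mulmxBr mulmx1 subKr mulmxA; apply: le_trans (KB _) _.
  by rewrite mulrC -ler_pdivlMr // mulrAC.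
- have [d d0 Hd] := graves oU Uxb CF.1 dF BJ e0.
  have [d2 d20 H2] := eball_sub_open oU Uxb.
  exists (Num.min d d2); first by rewrite lt_min d0.
  move=> q v Mq; rewrite !le_min => /andP[q1 /H2 Uq] /andP[vd _] /kerP vJ.
  have [q' [Uq' Fq'] Hq'] := Hd q v q1 (MUP q Mq Uq) vd vJ.
  by exists q' => //; exact: UMP.
Qed.

Lemma ler_enorm_sub_orthoproj P (x : 'rV[R]_n) : orthoproj P -> enorm (x - x *m P) <= enorm x.
Proof.
by move=> PP; rewrite -ler_sqr ?nnegrE // (pythagoras0 PP x) lerDl sqr_ge0.
Qed.

(** Correcting [t *: v] onto [M] via [P] gives a chord from [xb], which [Q] nearly fixes. Dividing
    by [t] and shrinking the tolerance gives the claim. *)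
Lemma tangent_proj_sub M xb P Q (v : 'rV[R]_n) : M xb ->
  tangent_proj M xb P -> tangent_proj M xb Q -> v *m P = v -> v *m Q = v.
Proof.
move=> Mxb [_ _ P2] [QQ Q1 _] vP.
suff : enorm (v - v *m Q) <= 0.
  move=> h; apply/eqP; rewrite eq_sym -subr_eq0; apply/eqP/enorm_eq0/eqP.
  by rewrite eq_le h enorm_ge0.
apply: (@le0_of_small _ _ (3 * enorm v)) => e e0 e1.
have [d1 d10 H1] := P2 e e0; have [d2 d20 H2] := Q1 e e0.
pose d := Num.min d1 d2; have d0 : 0 < d by rewrite lt_min d10.
have dd1 : d <= d1 by rewrite ge_min lexx.
have dd2 : d <= d2 by rewrite ge_min lexx orbT.
(* The corrected chord has length at most [2 * (t * enorm v)], hence at most [d]; the 1 covers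
   [v = 0]. *)
pose t := d / (2 * (enorm v + 1)).
have v1 : 0 < enorm v + 1 by rewrite ltr_wpDl.
have t0 : 0 < t by rewrite divr_gt0 // mulr_gt0.
have tv : 2 * (t * enorm v) <= d.
  have -> : d = 2 * (t * (enorm v + 1)) by rewrite /t; field; rewrite gt_eqF.
  by rewrite ler_pM2l // ler_pM2l // lerDl.
clearbody d t.
have tv0 : 0 <= t * enorm v by rewrite mulr_ge0 // ltW.
have etv : enorm (t *: v) = t * enorm v by rewrite enormZ gtr0_norm.
have [|||q Mq Hq] := H1 xb (t *: v) Mxb.
- by rewrite subrr enorm0 ltW.
- rewrite etv; lra.
- by rewrite -scalemxAl vP.
rewrite etv in Hq.
pose r := q - xb - t *: v.
have qr : q - xb = t *: v + r by rewrite /r [RHS]addrC subrK.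
have r1 : enorm r <= e * (t * enorm v) by [].
have r2 : e * (t * enorm v) <= t * enorm v by rewrite ler_piMl.
have q1 : enorm (q - xb) <= 2 * (t * enorm v).
  rewrite qr; have := ler_enormD (t *: v) r; rewrite etv; lra.
have := H2 q xb Mq Mxb (le_trans q1 (le_trans tv dd2)).
rewrite subrr enorm0 => /(_ (ltW d20)) h.
have {}h : enorm (q - xb - (q - xb) *m Q) <= e * (2 * (t * enorm v)).
  by apply: le_trans h _; rewrite ler_wpM2l // ltW.
have E : t *: (v - v *m Q) = (q - xb - (q - xb) *m Q) - (r - r *m Q).
  rewrite qr mulmxDl opprD addrACA -scalemxAl -scalerBr addrK //.
have : t * enorm (v - v *m Q) <= t * (e * (3 * enorm v)).
  rewrite -{1}(gtr0_norm t0) -enormZ E.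
  have := ler_enormB (q - xb - (q - xb) *m Q) (r - r *m Q).
  have := ler_enorm_sub_orthoproj r QQ; lra.
by rewrite ler_pM2l.
Qed.

(** Two symmetric projectors that each fix the range of the other coincide. Hence the tangent space
    does not depend on the defining function. *)
Lemma tangent_proj_unique M xb P Q : M xb ->
  tangent_proj M xb P -> tangent_proj M xb Q -> P = Q.
Proof.
move=> Mxb tP tQ.
have mulPQ P' Q' : tangent_proj M xb P' -> tangent_proj M xb Q' -> P' *m Q' = P'.
  move=> tP' tQ'; apply/row_matrixP => i; rewrite row_mul.
  apply: (tangent_proj_sub Mxb tP' tQ').
  by rewrite -row_mul; case: tP' => -[_ ->].
have [[Ps _] _ _] := tP; have [[Qs _] _ _] := tQ.
by rewrite -(mulPQ P Q) // -{1}Ps -{1}Qs -trmx_mul mulPQ.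
Qed.

Lemma Ck_le m (U : set 'rV[R]_n) i j : (i <= j)%N ->
  forall F : 'rV[R]_n -> 'rV[R]_m, Ck j U F -> Ck i U F.
Proof.
elim: i j => [|i IH] [|j] // ij F /=; first by case.
by move=> [cF [dF CF]]; split=> //; split=> // l; apply: (IH j).
Qed.

Lemma tangent_spaceE k M xb : (0 < k)%N -> M xb -> manifold_around k M xb ->
  exists2 P, tangent_proj M xb P & tangent_space M xb = [set v | v *m P = v].
Proof.
move=> k0 Mxb [m [U [F [oU Uxb CF rJ MU]]]].
have F1 : local_defining_function 1 M xb U F by split=> //; apply: Ck_le CF.
have [P tP kerP] := exists_tangent_proj F1.
exists P => //; apply/seteqP; split=> v /=; last first.
  by move=> /kerP vJ; exists m, U, F.
move=> [m' [U' [F' [F'1 vJ']]]].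
have [P' tP' kerP'] := exists_tangent_proj F'1.
by rewrite (tangent_proj_unique Mxb tP tP'); apply/kerP'.
Qed.

(** If the tangential part of [x - q] were too large, a short step from [q] along it, corrected back
    onto [M], would land closer to [x]. *)
Lemma nearest_normal M xb P : tangent_proj M xb P ->
  forall e : R, 0 < e -> exists2 d, 0 < d & forall x q, enorm (q - xb) <= d ->
    is_nearest M x q -> enorm ((x - q) *m P) <= e * enorm (x - q).
Proof.
move=> [PP _ P2] e e0; have [d d0 Hd] := P2 e e0; exists d => // x q qd [Mq qmin].
rewrite leNgt; apply/negP => lt.
set w := (x - q) *m P in lt; set X := enorm (x - q) in lt.
have X0 : 0 <= X by exact: enorm_ge0.
have N0 : 0 < enorm w by apply: le_lt_trans lt; rewrite mulr_ge0 // ltW.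
set N := enorm w in lt N0.
pose C := (1 + e) ^+ 2; have C0 : 0 < C by rewrite exprn_gt0 // ltr_wpDl.
(* A step of length [s] gains at least [2 * s * (N - e * X)] in squared distance and costs at most
   [C * s ^+ 2]; this [s] keeps the cost below the gain. *)
pose s := Num.min d ((N - e * X) / C).
have s0 : 0 < s by rewrite lt_min d0 divr_gt0 // subr_gt0.
have sd : s <= d by rewrite ge_min lexx.
have sC : C * s <= N - e * X.
  by rewrite mulrC -ler_pdivlMr // ge_min lexx orbT.
clearbody s.
pose v := (s / N) *: w.
have ev : enorm v = s.
  by rewrite /v enormZ gtr0_norm ?divr_gt0 // -/N divfK // gt_eqF.
have [||q' Mq' Hq'] := Hd q v Mq qd.
- by rewrite ev.
- by rewrite /v /w -scalemxAl -mulmxA PP.2.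
rewrite ev in Hq'.
pose b := q' - q.
have bs : enorm b <= (1 + e) * s.
  rewrite -[b](subrK v); have := ler_enormD (b - v) v; rewrite ev /b; lra.
have : X ^+ 2 <= enorm (x - q') ^+ 2 by rewrite ler_sqr ?nnegrE // qmin.
have -> : x - q' = (x - q) - b by rewrite /b opprB addrA subrK.
rewrite !sqr_enorm !(dotDl (x - q), dotDr _ (- b), dotNl, dotNr) (dotC b).
rewrite -!sqr_enorm -/X => h1.
have h2 : enorm b ^+ 2 <= ((1 + e) * s) ^+ 2.
  by rewrite ler_sqr ?nnegrE // mulr_ge0 ?addr_ge0 // ltW.
have dv : dot (x - q) v = s * N.
  rewrite /v dotZr /w; have -> : dot (x - q) ((x - q) *m P) = N ^+ 2.
    rewrite sqr_enorm /w dot_mulmxl PP.1 -mulmxA PP.2 //.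
  by field; rewrite gt_eqF.
have db : dot (x - q) (v - b) <= X * (e * s).
  apply: le_trans (cauchy_schwarz _ _) _; rewrite ler_wpM2l //.
  by rewrite enormB.
rewrite dotDr dotNr dv in db.
have h3 : 2 * (s * (N - X * e)) <= s * (C * s).
  by rewrite /C; move: h1 h2 db; lra.
have := ler_wpM2l (ltW s0) sC.
have : 0 < s * (N - e * X) by rewrite mulr_gt0 // subr_gt0.
lra.
Qed.

End TangentProjector.

(** * First-order calculus of projections *)

Section FirstOrder.
Variables (R : realType) (n : nat).
Implicit Types (C M : set 'rV[R]_n) (xb : 'rV[R]_n) (P A B : 'M[R]_n)
  (f g : 'rV[R]_n -> 'rV[R]_n).

(* The base point [y] is restricted to [C], where [f] will be the identity. *)
Definition first_order C xb f A := forall e : R, 0 < e ->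
  exists2 d : R, 0 < d & forall x y, enorm (x - xb) <= d -> enorm (y - xb) <= d ->
    C y -> enorm (f x - y - (x - y) *m A) <= e * enorm (x - y).

(** Expand [g] at [f x] with the same base point [y]; the error of [f] passes through [B]. *)
Lemma first_order_comp C xb f g A B :
  first_order C xb f A -> first_order C xb g B ->
  first_order C xb (g \o f) (A *m B).
Proof.
move=> fA gB e e0.
have [KA KA0 HA] := mulmx_bounded A; have [KB KB0 HB] := mulmx_bounded B.
have D0 : 0 < KA + 1 + KB by lra.
pose e' := Num.min 1 (e / (KA + 1 + KB)).
have e'0 : 0 < e' by rewrite lt_min ltr01 divr_gt0.
have e'1 : e' <= 1 by rewrite ge_min lexx.
have e'e : e' * (KA + 1 + KB) <= e by rewrite -ler_pdivlMr // ge_min lexx orbT.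
clearbody e'.
have [d1 d10 H1] := fA e' e'0; have [d2 d20 H2] := gB e' e'0.
(* [f x] stays within [L * d] of [xb]: [x - y] has length at most [2 * d], [f] stretches it by at
   most [KA + 1], and [y] adds [d]. *)
pose L := 2 * (KA + 1) + 1; have L0 : 0 < L by rewrite /L; lra.
pose d := Num.min d1 (d2 / L).
have d0 : 0 < d by rewrite lt_min d10 divr_gt0.
have dd1 : d <= d1 by rewrite ge_min lexx.
have dL : L * d <= d2 by rewrite mulrC -ler_pdivlMr // ge_min lexx orbT.
clearbody d; exists d => // x y xd yd Cy.
have h1 := H1 x y (le_trans xd dd1) (le_trans yd dd1) Cy.
set r := f x - y - (x - y) *m A in h1.
have fr : f x - y = (x - y) *m A + r by rewrite /r [RHS]addrC subrK.
have xy0 := enorm_ge0 (x - y).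
have h1' : enorm r <= enorm (x - y) by apply: le_trans h1 _; rewrite ler_piMl.
have fxy : enorm (f x - y) <= (KA + 1) * enorm (x - y).
  rewrite fr; have := ler_enormD ((x - y) *m A) r; have := HA (x - y); lra.
have xyd : enorm (x - y) <= 2 * d.
  have := enorm_dist_triangle xb x y; rewrite (enormB xb); lra.
have dd2 : d <= d2.
  by apply: le_trans dL; rewrite ler_peMl ?(ltW d0) // /L; lra.
have fxd : enorm (f x - xb) <= d2.
  have := enorm_dist_triangle y (f x) xb.
  have KA1 : 0 <= KA + 1 by lra.
  have := ler_wpM2l KA1 xyd; rewrite /L in dL; lra.
have h2 := H2 (f x) y fxd (le_trans yd dd2) Cy.
have -> : (g \o f) x - y - (x - y) *m (A *m B) =
    (g (f x) - y - (f x - y) *m B) + r *m B.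
  by rewrite fr mulmxDl mulmxA opprD addrA subrK.
have := ler_enormD (g (f x) - y - (f x - y) *m B) (r *m B).
have := HB r; have := ler_wpM2l (ltW KB0) h1; have := ler_wpM2l (ltW e'0) fxy.
have := ler_wpM2r xy0 e'e; lra.
Qed.

Lemma first_order_relax C xb f A (a : R) : 0 <= a ->
  first_order C xb f A ->
  first_order C xb (fun x => (1 - a) *: x + a *: f x) ((1 - a)%:M + a *: A).
Proof.
move=> a0 fA e e0; have a1 : 0 < a + 1 by lra.
have [d d0 Hd] := fA (e / (a + 1)) (divr_gt0 e0 a1).
exists d => // x y xd yd Cy.
have -> : (1 - a) *: x + a *: f x - y - (x - y) *m ((1 - a)%:M + a *: A) =
    a *: (f x - y - (x - y) *m A).
  rewrite mulmxDr mul_mx_scalar -scalemxAr.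
  move: ((x - y) *m A) => z; rewrite !scalerBr !scalerBl !scale1r.
  by apply/rowP => i; rewrite !mxE; ring.
rewrite enormZ ger0_norm //.
apply: le_trans (ler_wpM2l a0 (Hd x y xd yd Cy)) _.
rewrite mulrA ler_wpM2r // mulrA ler_pdivrMr // mulrC ler_wpM2l ?(ltW e0) //.
by rewrite lerDl.
Qed.

Lemma first_order_sub C M xb f A :
  C `<=` M -> first_order M xb f A -> first_order C xb f A.
Proof.
move=> CM fA e /fA[d d0 Hd]; exists d => // x y xd yd /CM; exact: Hd.
Qed.

Lemma first_order_iter C xb f A j :
  first_order C xb f A -> first_order C xb (iter j f) (A ^+ j).
Proof.
move=> fA; elim: j => [|j IH].
  move=> e e0; exists 1 => // x y _ _ _.
  by rewrite expr0 mulmx1 subrr enorm0 mulr_ge0 // ltW.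
by rewrite exprSr; exact: (first_order_comp IH fA).
Qed.

Lemma ler_enorm_nearest C x q y : is_nearest C x q -> C y ->
  enorm (x - q) <= enorm (x - y).
Proof. by move=> [_]; apply. Qed.

(** The error splits into the normal part of the chord [q - y] and the tangential part of [x - q].
    The chord may be twice as long as [x - y], hence the tolerance [e / 3]. *)
Lemma first_order_projC M xb P : closed M -> M xb -> tangent_proj M xb P ->
  first_order M xb (projC M) P.
Proof.
move=> cM Mxb tP e e0.
have e30 : 0 < e / 3 by rewrite divr_gt0.
have [d1 d10 H1] := nearest_normal tP e30.
have [_ H2 _] := tP; have [d2 d20 {}H2] := H2 _ e30.
pose d := Num.min d1 d2 / 3.
have d0 : 0 < d by rewrite divr_gt0 // lt_min d10.
have d3 : 3 * d = Num.min d1 d2 by rewrite /d; field.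
have dd1 : 3 * d <= d1 by rewrite d3 ge_min lexx.
have dd2 : 3 * d <= d2 by rewrite d3 ge_min lexx orbT.
clearbody d; exists d => // x y xd yd My.
have qN : is_nearest M x (projC M x) by apply: exists_nearest => //; exists xb.
move: (projC M x) qN => q qN.
have xq := ler_enorm_nearest qN My.
have xq' := ler_enorm_nearest qN Mxb.
have qd : enorm (q - xb) <= 3 * d.
  have := enorm_dist_triangle x q xb; rewrite (enormB q x); lra.
have h1 := H1 x q (le_trans qd dd1) qN.
have h2 : enorm (q - y - (q - y) *m P) <= e / 3 * enorm (q - y).
  by apply: H2 => //; [case: qN | exact: le_trans qd dd2 | lra].
have qy : enorm (q - y) <= 2 * enorm (x - y).
  have := enorm_dist_triangle x q y; rewrite (enormB q x); lra.
have -> : q - y - (x - y) *m P = (q - y - (q - y) *m P) - (x - q) *m P.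
  by rewrite !mulmxBl; apply/rowP => i; rewrite !mxE; ring.
have := ler_enormB (q - y - (q - y) *m P) ((x - q) *m P).
have := ler_wpM2l (ltW e30) qy; have := ler_wpM2l (ltW e30) xq; lra.
Qed.

(** With [p] nearest to [x], [(x - p) *m A] differs from [(x - p) *m (A - P)] by the tangential part
    of [x - p], small by [nearest_normal]. *)
Lemma first_order_contraction C xb f A P (K : R) :
  closed C -> C xb -> tangent_proj C xb P -> first_order C xb f A ->
  (forall v : 'rV_n, enorm (v *m A - v *m P) <= K * enorm v) ->
  forall e : R, 0 < e -> exists2 d : R, 0 < d & forall x, eball xb d x ->
    enorm (f x - projC C x) <= (K + e) * enorm (x - projC C x).
Proof.
move=> cC Cxb tP fA AK e e0; have e20 : 0 < e / 2 by rewrite divr_gt0.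
have [d1 d10 H1] := nearest_normal tP e20.
have [d2 d20 H2] := fA _ e20.
pose d := Num.min d1 d2 / 2.
have d0 : 0 < d by rewrite divr_gt0 // lt_min d10.
have d3 : 2 * d = Num.min d1 d2 by rewrite /d; field.
have dd1 : 2 * d <= d1 by rewrite d3 ge_min lexx.
have dd2 : 2 * d <= d2 by rewrite d3 ge_min lexx orbT.
clearbody d; exists d => // x; rewrite /eball /= => xd.
have qN : is_nearest C x (projC C x) by apply: exists_nearest => //; exists xb.
move: (projC C x) qN => p pN.
have xp := ler_enorm_nearest pN Cxb.
have pd : enorm (p - xb) <= 2 * d.
  have := enorm_dist_triangle x p xb; rewrite (enormB p x); lra.
have h1 := H1 x p (le_trans pd dd1) pN.
have h2 : enorm (f x - p - (x - p) *m A) <= e / 2 * enorm (x - p).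
  by apply: H2; [lra | exact: le_trans pd dd2 | case: pN].
have -> : f x - p = (f x - p - (x - p) *m A) +
    (((x - p) *m A - (x - p) *m P) + (x - p) *m P) by rewrite subrK subrK.
have := ler_enormD (f x - p - (x - p) *m A)
  (((x - p) *m A - (x - p) *m P) + (x - p) *m P).
have := ler_enormD ((x - p) *m A - (x - p) *m P) ((x - p) *m P).
have := AK (x - p); lra.
Qed.

Lemma ler_opnorm B (v : 'rV[R]_n) :
  enorm (v *m B) <= opnorm (fun x => x *m B) * enorm v.
Proof.
have [K K0 HK] := mulmx_bounded B.
have [v0|v0] := eqVneq (enorm v) 0.
  by rewrite (enorm_eq0 v0) mul0mx enorm0 mulr0.
have vp : 0 < enorm v by rewrite lt_neqAle eq_sym v0 enorm_ge0.
rewrite -ler_pdivrMr //; apply: ub_le_sup.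
  exists K => _ [x /= x1 <-]; apply: le_trans (HK x) _.
  by rewrite ler_piMr // ltW.
exists ((enorm v)^-1 *: v) => /=.
  by rewrite enormZ gtr0_norm ?invr_gt0 // mulVf.
by rewrite -scalemxAl enormZ gtr0_norm ?invr_gt0 // mulrC.
Qed.

End FirstOrder.

(** * Powers of a matrix and its spectrum *)

Section SpectralRadius.

Lemma geometric_recurrence_bound (K : numFieldType) (w : nat -> K) (z r D : K) :
  `|z| < r -> (forall j, `|w j.+1 - z * w j| <= D * r ^+ j) ->
  exists D', forall j, `|w j| <= D' * r ^+ j.
Proof.
move=> zr wD.
have D0 : 0 <= D by have := wD 0; rewrite expr0 mulr1; apply: le_trans.
have rz0 : 0 < r - `|z| by rewrite subr_gt0.
have r0 : 0 <= r by apply: le_trans (ltW zr).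
(* Large enough that [D + |z| D' <= r D'], which propagates the bound. *)
pose D' := `|w 0| + D / (r - `|z|).
have DD' : D <= (r - `|z|) * D'.
  rewrite mulrDr mulrCA divff ?gt_eqF // mulr1 lerDr.
  by rewrite mulr_ge0 // ltW.
exists D'; elim=> [|j IH].
  by rewrite expr0 mulr1 /D' lerDl divr_ge0 // ltW.
rewrite -[w j.+1](subrK (z * w j)); apply: le_trans (ler_normD _ _) _.
apply: (@le_trans _ _ (D * r ^+ j + `|z| * (D' * r ^+ j))).
  by rewrite lerD // normrM ler_wpM2l.
rewrite -lerBrDr exprS.
have -> : D' * (r * r ^+ j) - `|z| * (D' * r ^+ j) = (r - `|z|) * D' * r ^+ j by ring.
by rewrite ler_wpM2r ?exprn_ge0.
Qed.

(* By Cayley-Hamilton the product of the [A - z] over the eigenvalues [z]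
   vanishes; its factors are removed one at a time. *)
Lemma expmx_bound (C : numClosedFieldType) n (A : 'M[C]_n) (r : C) :
  (forall z, root (char_poly A) z -> `|z| < r) ->
  forall i l, exists D, forall j, `|(A ^+ j) i l| <= D * r ^+ j.
Proof.
case: n A => [A _ []//|n A Ar].
have [rs] := closed_field_poly_normal (char_poly A).
rewrite (monicP (char_poly_monic A)) scale1r => Ars.
have {}Ar z : z \in rs -> `|z| < r.
  by move=> zrs; apply: Ar; rewrite Ars root_prod_XsubC.
have CH : \prod_(z <- rs) (A - z%:M) = 0.
  rewrite -(Cayley_Hamilton A) Ars rmorph_prod; apply: eq_bigr => z _.
  by rewrite rmorphB /= horner_mx_X horner_mx_C.
suff strip s : {subset s <= rs} ->
    (forall i l, exists D, forall j,
      `|(A ^+ j * \prod_(z <- s) (A - z%:M)) i l| <= D * r ^+ j) ->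
    forall i l, exists D, forall j, `|(A ^+ j) i l| <= D * r ^+ j.
  apply: (strip rs) => // i l; exists 0 => j.
  by rewrite CH mulr0 mxE normr0 mul0r.
elim: s => [|z s IH] srs H.
  by move=> i l; have [D HD] := H i l; exists D => j; have := HD j; rewrite big_nil mulr1.
apply: IH => [x xs|i l]; first by apply: srs; rewrite inE xs orbT.
have [D HD] := H i l.
apply: (@geometric_recurrence_bound _ _ z r D); first by apply/Ar/srs/mem_head.
(* Entries of [A ^+ j * Q] satisfy the recurrence whose defect is the corresponding entry of
   [A ^+ j * (A - z) * Q]. *)
move=> j; have := HD j; rewrite big_cons mulrA mulrBr mulrBl -exprSr.
set Q := \prod_(_ <- s) _.
have -> : A ^+ j * z%:M * Q = z *: (A ^+ j * Q).
  by rewrite -[A ^+ j * z%:M]/(A ^+ j *m z%:M) mul_mx_scalar -scalerAl.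
by rewrite !mxE.
Qed.

Section Real.
Variable R : realType.
Local Notation toC := (map_mx (fun r : R => (r%:C)%C)).
Local Notation cnorm z := (Num.sqrt (complex.Re z ^+ 2 + complex.Im z ^+ 2)).

Lemma normcE (z : R[i]) : `|z| = ((cnorm z)%:C)%C.
Proof. exact: normc_def. Qed.

(** For [r] strictly between the spectral bound and [mu], the powers are at most [K * r ^+ j], and
    [(r / mu) ^+ j] eventually absorbs [K]. *)
Lemma expmx_eventually_le n (A : 'M[R]_n) (rho mu : R) : rho < mu -> 0 < mu ->
  (forall z : R[i], root (char_poly (toC A)) z -> cnorm z <= rho) ->
  exists N0 : nat, forall j, (N0 <= j)%N -> forall v : 'rV_n,
    enorm (v *m A ^+ j) <= mu ^+ j * enorm v.
Proof.
move=> rhomu mu0 Arho.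
pose r := (Num.max rho 0 + mu) / 2.
have m0 : Num.max rho 0 < mu by rewrite gt_max rhomu.
have r0 : 0 < r by rewrite /r; have : 0 <= Num.max rho 0 by [rewrite le_max lexx orbT]; lra.
have rr : rho < r by rewrite /r; have : rho <= Num.max rho 0 by [rewrite le_max lexx]; lra.
have rmu : r < mu by rewrite /r; lra.
clearbody r.
have [D HD] : exists D : 'I_n -> 'I_n -> R, forall i l j, `|(A ^+ j) i l| <= D i l * r ^+ j.
  have H i l : exists D : R, forall j, `|(A ^+ j) i l| <= D * r ^+ j.
    have [z /Arho zr|D HD] := @expmx_bound _ n (toC A) (r%:C)%C _ i l.
      by rewrite normcE ltcR (le_lt_trans zr).
    exists (complex.Re D) => j; have := HD j.
    have -> : (toC A) ^+ j = toC (A ^+ j).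
      elim: j => [|j IH]; first by rewrite !expr0 (map_mx1 (real_complex R)).
      by rewrite !exprS IH (map_mxM (real_complex R)).
    rewrite mxE normcE /= expr0n addr0 sqrtr_sqr -rmorphXn /= lecE => /andP[_].
    by case: D {HD} => x y /=; rewrite mulr0 subr0.
  exists (fun i l => sval (cid (H i l))) => i l; exact: (svalP (cid (H i l))).
pose K := \sum_i \sum_l `|D i l|.
have bound j (v : 'rV_n) : enorm (v *m A ^+ j) <= K * r ^+ j * enorm v.
  rewrite {1}(row_sum_unitv v) mulmx_suml; apply: le_trans (ler_enorm_sum _ _) _.
  rewrite /K !mulr_suml; apply: ler_sum => i _.
  rewrite -scalemxAl enormZ mulrC ler_pM // ?ler_coord_enorm //.
  rewrite -rowE (row_sum_unitv (row i _)); apply: le_trans (ler_enorm_sum _ _) _.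
  rewrite mulr_suml; apply: ler_sum => l _; rewrite enormZ enorm_unitv mulr1 mxE.
  apply: le_trans (HD i l j) _.
  by rewrite ler_wpM2r ?exprn_ge0 ?(ltW r0) // ler_norm.
have K0 : 0 <= K by apply: sumr_ge0 => i _; apply: sumr_ge0.
have q1 : `|r / mu| < 1.
  by rewrite ger0_norm ?divr_ge0 ?(ltW r0) ?(ltW mu0) // ltr_pdivrMr // mul1r.
have eps0 : 0 < (K + 1)^-1 by rewrite invr_gt0 ltr_wpDl.
have /cvgrPdist_le /(_ _ eps0) [N0 _ HN0] := cvg_expr q1.
exists N0 => j jN v; apply: le_trans (bound j v) _; rewrite ler_wpM2r //.
have := HN0 j jN; rewrite /= sub0r normrN ger0_norm ?exprn_ge0 ?divr_ge0 ?(ltW r0) ?(ltW mu0) //.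
have -> : r ^+ j = (r / mu) ^+ j * mu ^+ j by rewrite -exprMn divfK // gt_eqF.
rewrite mulrA => h; rewrite ler_piMl ?exprn_ge0 ?(ltW mu0) //.
apply: (@le_trans _ _ ((K + 1) * (K + 1)^-1)); last by rewrite divff // gt_eqF // ltr_wpDl.
by rewrite ler_pM ?exprn_ge0 ?divr_ge0 ?(ltW r0) ?(ltW mu0) ?lerDl // ltr_wpDl.
Qed.

End Real.
End SpectralRadius.

(** * Eigenvalues and fixed points of relaxed projections *)

Section Gamma.
Variables (R : realType) (n : nat).
Implicit Types (A P : 'M[R]_n).
Local Notation toC := (map_mx (fun r : R => (r%:C)%C)).
Local Notation cnorm z := (Num.sqrt (complex.Re z ^+ 2 + complex.Im z ^+ 2)).

(** A [sup] dominates its set only if that set is bounded; the sum of the moduli of all roots is a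
    bound. *)
Lemma gamma_ub A r :
  r = 0 \/ (exists z : R[i], root (char_poly (toC A)) z /\ z != 1 /\ r = cnorm z) ->
  r <= gamma A.
Proof.
move=> rA; apply: ub_le_sup => //.
have [rs] := closed_field_poly_normal (char_poly (toC A)).
rewrite (monicP (char_poly_monic _)) scale1r => Ars.
exists (\sum_(z <- rs) cnorm z) => _ [->|[z [zr [_ ->]]]].
  by apply: sumr_ge0 => z _; exact: sqrtr_ge0.
move: zr; rewrite Ars root_prod_XsubC => zrs.
by rewrite (big_rem z) //= lerDl; apply: sumr_ge0 => ? _; exact: sqrtr_ge0.
Qed.

(** Splits a complex vector fixed by a real matrix into two real fixed vectors. *)
Lemma Re_mulmx (v : 'rV[R[i]]_n) A :
  map_mx (@complex.Re R) (v *m toC A) = map_mx (@complex.Re R) v *m A.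
Proof.
apply/rowP => l; rewrite !mxE raddf_sum; apply: eq_bigr => k _.
by rewrite !mxE; case: (v 0 k) => x y /=; rewrite mulr0 subr0.
Qed.

Lemma Im_mulmx (v : 'rV[R[i]]_n) A :
  map_mx (@complex.Im R) (v *m toC A) = map_mx (@complex.Im R) v *m A.
Proof.
apply/rowP => l; rewrite !mxE raddf_sum; apply: eq_bigr => k _.
by rewrite !mxE; case: (v 0 k) => x y /=; rewrite mulr0 add0r.
Qed.

Lemma complex_rowP (v w : 'rV[R[i]]_n) :
  map_mx (@complex.Re R) v = map_mx (@complex.Re R) w ->
  map_mx (@complex.Im R) v = map_mx (@complex.Im R) w -> v = w.
Proof.
move=> /rowP rvw /rowP ivw; apply/rowP => l; apply/eqP; rewrite eq_complex.
by have := rvw l; have := ivw l; rewrite !mxE => -> ->; rewrite !eqxx.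
Qed.

(* Removing the eigenvalue 1 of [A] turns [gamma A] into a spectral radius. *)
Lemma spectrum_sub_fixed A P : P *m P = P -> A *m P = P ->
  (forall v : 'rV_n, v *m A = v -> v *m P = v) ->
  forall z : R[i], root (char_poly (toC (A - P))) z -> cnorm z <= gamma A.
Proof.
move=> PP AP fixA z.
rewrite -eigenvalue_root_char => /eigenvalueP[v vz v0].
have [->|z0] := eqVneq z 0.
  by rewrite /= expr0n addr0 sqrtr0; apply: gamma_ub; left.
(* [(A - P) *m P = 0], so [P] kills eigenvectors for nonzero eigenvalues, and these are then
   eigenvectors of [A]. *)
have vP : v *m toC P = 0.
  have : (z *: v) *m toC P = 0.
    rewrite -vz -mulmxA -(map_mxM (real_complex R)) mulmxBl AP PP subrr.
    by rewrite (map_mx0 (real_complex R)) mulmx0.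
  by rewrite -scalemxAl => /eqP; rewrite scaler_eq0 (negPf z0) => /eqP.
have vA : v *m toC A = z *: v.
  by rewrite -vz (map_mxB (real_complex R)) mulmxBr vP subr0.
apply: gamma_ub; right; exists z; split.
  by rewrite -eigenvalue_root_char; apply/eigenvalueP; exists v.
(* For [z = 1], [v] would be fixed by [A], hence by [P], which kills it. *)
split=> //; apply/eqP => z1; move: v0; rewrite z1 scale1r in vA.
suff -> : v = 0 by rewrite eqxx.
rewrite -vP; apply: complex_rowP.
  by rewrite Re_mulmx fixA // -Re_mulmx vA.
by rewrite Im_mulmx fixA // -Im_mulmx vA.
Qed.

(** All products involving [P] collapse to [P]. At [j = 0] the left side is the identity, so
    positivity matters. *)
Lemma expmx_sub_fixed A P j : P *m P = P -> A *m P = P -> P *m A = P ->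
  (0 < j)%N -> (A - P) ^+ j = A ^+ j - P.
Proof.
move=> PP AP PA; case: j => // j _.
have AjP k : A ^+ k *m P = P.
  elim: k => [|k IH]; first by rewrite expr0 mul1mx.
  by rewrite exprSr -[A ^+ k * A]/(A ^+ k *m A) -mulmxA AP.
elim: j => [|j IH]; first by rewrite !expr1.
rewrite exprSr IH -[LHS]/((A ^+ j.+1 - P) *m (A - P)) mulmxBl !mulmxBr AjP PA PP.
by rewrite subrr subr0 [in RHS]exprSr.
Qed.

End Gamma.

Section Relaxed.
Variables (R : realType) (n : nat).
Implicit Types (P : 'M[R]_n) (al : R) (x : 'rV[R]_n).

Definition relax al P : 'M[R]_n := (1 - al)%:M + al *: P.

Lemma mulmx_relax x al P : x *m relax al P = x - al *: (x - x *m P).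
Proof.
rewrite /relax mulmxDr mul_mx_scalar -scalemxAr scalerBr scalerBl scale1r.
by rewrite opprB addrA addrAC.
Qed.

(** Gives the exact loss of norm: none for a reflection, [al = 2], and a strict one for [0 < al < 2]
    unless [P] fixes [x]. *)
Lemma relax_pythagoras x al P : orthoproj P ->
  enorm (x *m relax al P) ^+ 2 =
  enorm x ^+ 2 - al * (2 - al) * enorm (x - x *m P) ^+ 2.
Proof.
move=> PP; have := pythagoras0 PP x; have := dot_orthoproj PP x x.
rewrite mulmx_relax; set u := x - x *m P => xu _.
have dxu : dot x u = enorm u ^+ 2.
  by rewrite sqr_enorm -{1}[x](subrK (x *m P)) -/u dotDl xu addr0.
clearbody u.
by rewrite !sqr_enorm !(dotDl, dotDr, dotNl, dotNr, dotZl, dotZr) (dotC u x) dxu -!sqr_enorm; ring.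
Qed.

Lemma relax_fixed x al P : al != 0 -> (x *m relax al P == x) = (x *m P == x).
Proof.
move=> al0; rewrite mulmx_relax -subr_eq0 addrC addKr oppr_eq0 scaler_eq0.
by rewrite (negPf al0) /= subr_eq0 eq_sym.
Qed.

(** Vectors are rows, so the factor for [PN], applied first, stands on the left. *)
Definition gap_mx (a a1 a2 : R) (PM PN : 'M[R]_n) : 'M[R]_n :=
  (1 - a)%:M + a *: (relax a1 PN *m relax a2 PM).

(** A fixed point is fixed by the composition of both relaxations, so neither may lose norm. The one
    with parameter below 2 must then fix its argument, which leaves a fixed point of the other, even
    if that is a reflection. *)
Lemma gap_mx_fixed (a a1 a2 : R) PM PN x : orthoproj PM -> orthoproj PN ->
  0 < a -> 0 < a1 <= 2 -> 0 < a2 <= 2 -> a1 < 2 \/ a2 < 2 ->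
  x *m gap_mx a a1 a2 PM PN = x -> x *m PM = x /\ x *m PN = x.
Proof.
move=> oM oN a0 /andP[a10 a12] /andP[a20 a22] lt2.
rewrite /gap_mx mulmxDr mul_mx_scalar -scalemxAr mulmxA scalerBl scale1r.
set y := x *m relax a1 PN => xA.
have xy : y *m relax a2 PM = x.
  have : a *: (y *m relax a2 PM - x) == 0.
    have -> : a *: (y *m relax a2 PM - x) = x - a *: x + a *: (y *m relax a2 PM) - x.
      by rewrite scalerBr addrAC [x - _]addrC addrK addrC.
    by rewrite xA subrr.
  by rewrite scaler_eq0 gt_eqF //= subr_eq0 => /eqP.
have := relax_pythagoras y a2 oM; rewrite xy.
have := relax_pythagoras x a1 oN; rewrite -/y => ->.
set U := enorm (x - _) ^+ 2; set V := enorm (y - _) ^+ 2 => E.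
have U0 : 0 <= U by exact: sqr_ge0.
have V0 : 0 <= V by exact: sqr_ge0.
have c1 : 0 <= a1 * (2 - a1) by rewrite mulr_ge0 ?(ltW a10) // subr_ge0.
have c2 : 0 <= a2 * (2 - a2) by rewrite mulr_ge0 ?(ltW a20) // subr_ge0.
have cU := mulr_ge0 c1 U0; have cV := mulr_ge0 c2 V0.
have cU0 : a1 * (2 - a1) * U = 0 by lra.
have cV0 : a2 * (2 - a2) * V = 0 by lra.
have n1 : a1 != 0 by rewrite gt_eqF.
have n2 : a2 != 0 by rewrite gt_eqF.
have proj_of (w : 'rV[R]_n) P c : c < 2 -> 0 < c ->
    c * (2 - c) * enorm (w - w *m P) ^+ 2 = 0 -> w *m P = w.
  move=> c2' c0' /eqP; rewrite !mulf_eq0 gt_eqF //= gt_eqF ?subr_gt0 //=.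
  by rewrite orbb => /eqP/enorm_eq0/eqP; rewrite subr_eq0 => /eqP.
case: lt2 => lt.
- have xN : x *m PN = x by exact: proj_of cU0.
  have yx : y = x by apply/eqP; rewrite relax_fixed //; apply/eqP.
  by split=> //; apply/eqP; rewrite -(relax_fixed _ _ n2) -{1}yx xy.
- have yM : y *m PM = y by exact: proj_of cV0.
  have yx : x = y by rewrite -xy; apply/eqP; rewrite relax_fixed //; apply/eqP.
  by split; [rewrite yx | apply/eqP; rewrite -(relax_fixed _ _ n1) -/y -yx].
Qed.

End Relaxed.

(** * Generalized alternating projections and their linearisation *)

Lemma GAP_orthoproj (R : realType) n (a a1 a2 : R) (PM PN : 'M[R]_n) :
  orthoproj PM -> orthoproj PN ->
  GAP a a1 a2 [set v | v *m PM = v] [set v | v *m PN = v] =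
  mulmx^~ (gap_mx a a1 a2 PM PN).
Proof.
move=> oM oN; apply/funext => x.
have rprojE al P y : orthoproj P -> rproj al [set v | v *m P = v] y = y *m relax al P.
  by move=> oP; rewrite /rproj projC_orthoproj // /relax mulmxDr mul_mx_scalar -scalemxAr.
by rewrite /GAP !rprojE // [RHS]mulmxDr mul_mx_scalar -scalemxAr mulmxA.
Qed.

Lemma mx_of_mulmx (R : realType) n (A : 'M[R]_n) : mx_of (mulmx^~ A) = A.
Proof. by apply/matrixP => i j; rewrite mxE -rowE mxE. Qed.

Theorem theorem4 (R : realType) (n k : nat) (M N : set 'rV[R]_n)
    (xb : 'rV[R]_n) (a a1 a2 : R) :
  (2 <= k)%N -> closed M -> closed N -> M xb -> N xb ->
  manifold_around k M xb -> manifold_around k N xb ->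
  manifold_around k (M `&` N) xb ->
  tangent_space (M `&` N) xb = tangent_space M xb `&` tangent_space N xb ->
  0 < a <= 1 -> 0 < a1 <= 2 -> 0 < a2 <= 2 ->
  ((a1 < 2 /\ a2 < 2) \/ (a < 1 /\ (a1 != 2 \/ a2 != 2))) ->
  let S := GAP a a1 a2 M N in
  let TM := tangent_space M xb in
  let TN := tangent_space N xb in
  let ST := GAP a a1 a2 TM TN in
  (forall c : R, opnorm (fun x => ST x - projC (TM `&` TN) x) < c ->
     exists eta : R, 0 < eta /\
       forall x, eball xb eta x ->
         enorm (S x - projC (M `&` N) x) <= c * enorm (x - projC (M `&` N) x))
  /\
  (forall mu : R, gamma (mx_of ST) < mu < 1 ->
     exists N0 : nat, forall j : nat, (N0 <= j)%N ->
       (* limsup_{x -> xb, x \notin M cap N} ratio <= mu^j, unfolded *)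
       forall eps : R, 0 < eps -> exists delta : R, 0 < delta /\
         forall x, eball xb delta x -> ~ (M `&` N) x ->
           enorm (iter j S x - projC (M `&` N) x) / enorm (x - projC (M `&` N) x)
             <= mu ^+ j + eps).
Proof.
move=> k2 cM cN Mxb Nxb mM mN mMN TMN /andP[a0 _] a1b a2b B.
(* Both (B1) and (B2) exclude two simultaneous reflections. *)
have lt2 : a1 < 2 \/ a2 < 2.
  case: B => [[? _]|[_ [ne|ne]]]; [by left|left|right].
    by have /andP[_ le] := a1b; rewrite lt_neqAle ne.
  by have /andP[_ le] := a2b; rewrite lt_neqAle ne.
have k0 : (0 < k)%N by apply: ltnW.
have Cxb : (M `&` N) xb by [].
have [PM tPM TM_E] := tangent_spaceE k0 Mxb mM.
have [PN tPN TN_E] := tangent_spaceE k0 Nxb mN.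
have [P tP T_E] := tangent_spaceE k0 Cxb mMN.
rewrite TMN in T_E.
move=> S TM TN ST; set C := M `&` N.
(* Closedness provides nearest points, so [projC] never takes its default value; the estimates hold
   whichever nearest point it selects. *)
have cC : closed C by exact: closedI.
have [oM _ _] := tPM; have [oN _ _] := tPN; have [oP _ _] := tP.
pose A := gap_mx a a1 a2 PM PN.
have ST_E : ST = mulmx^~ A by rewrite /ST /TM /TN TM_E TN_E GAP_orthoproj.
have PT : projC (TM `&` TN) = mulmx^~ P.
  by rewrite /TM /TN T_E; apply/funext => x; rewrite projC_orthoproj.
(* The tangent space condition on the intersection enters here. *)
have fixP (v : 'rV[R]_n) : v *m P = v <-> v *m PM = v /\ v *m PN = v.
  have : [set v | v *m P = v] v = ([set v | v *m PM = v] `&` [set v | v *m PN = v]) v.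
    by rewrite -T_E TM_E TN_E.
  by move=> /= ->.
have PP : P *m P = P by case: oP.
have [PPM PPN] : P *m PM = P /\ P *m PN = P.
  have rowP' i : row i P *m P = row i P by rewrite -row_mul PP.
  by split; apply/row_matrixP => i; rewrite row_mul; have /fixP[] := rowP' i.
have tr Q : orthoproj Q -> P *m Q = P -> Q *m P = P.
  by move=> [Qs _] PQ; rewrite -[RHS]oP.1 -[in RHS]PQ trmx_mul Qs oP.1.
have PMP := tr _ oM PPM; have PNP := tr _ oN PPN.
have Prelax al Q : P *m Q = P -> P *m relax al Q = P.
  by move=> PQ; rewrite mulmxDr mul_mx_scalar -scalemxAr PQ -scalerDl subrK scale1r.
have relaxP al Q : Q *m P = P -> relax al Q *m P = P.
  by move=> QP; rewrite mulmxDl mul_scalar_mx -scalemxAl QP -scalerDl subrK scale1r.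
have PA : P *m A = P.
  rewrite [LHS]mulmxDr mul_mx_scalar -scalemxAr mulmxA !Prelax //.
  by rewrite -scalerDl subrK scale1r.
have AP : A *m P = P.
  rewrite [LHS]mulmxDl mul_scalar_mx -scalemxAl -mulmxA !relaxP //.
  by rewrite -scalerDl subrK scale1r.
have fixA (v : 'rV[R]_n) : v *m A = v -> v *m P = v.
  by move=> vA; apply/fixP; exact: gap_mx_fixed vA.
(* Base points in [C] lie in both manifolds, so the two expansions share them and compose. *)
have SA : first_order C xb S A.
  have fN : first_order C xb (rproj a1 N) (relax a1 PN).
    apply: first_order_relax; first by case/andP: a1b => /ltW.
    by apply: first_order_sub (first_order_projC cN Nxb tPN) => x [].
  have fM : first_order C xb (rproj a2 M) (relax a2 PM).
    apply: first_order_relax; first by case/andP: a2b => /ltW.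
    by apply: first_order_sub (first_order_projC cM Mxb tPM) => x [].
  exact: first_order_relax (ltW a0) (first_order_comp fN fM).
split=> [c|mu /andP[gmu mu1]].
  have -> : (fun x => ST x - projC (TM `&` TN) x) = mulmx^~ (A - P).
    by apply/funext => x; rewrite ST_E PT mulmxBr.
  rewrite -subr_gt0 => c0.
  have BK (v : 'rV[R]_n) : enorm (v *m A - v *m P) <=
      opnorm (fun x : 'rV[R]_n => x *m (A - P)) * enorm v.
    by rewrite -mulmxBr; exact: ler_opnorm.
  have [d d0 Hd] := first_order_contraction cC Cxb tP SA BK c0.
  by exists d; split=> // x /Hd; rewrite [_ + (c - _)]addrC subrK.
rewrite ST_E mx_of_mulmx in gmu.
have g0 : 0 <= gamma A by apply: gamma_ub; left.
have mu0 : 0 < mu by apply: le_lt_trans gmu.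
have [N0 HN0] := expmx_eventually_le gmu mu0 (spectrum_sub_fixed PP AP fixA).
(* The successor makes [j] positive, as [expmx_sub_fixed] requires. *)
exists N0.+1 => j jN eps eps0.
have AjP (v : 'rV[R]_n) : enorm (v *m A ^+ j - v *m P) <= mu ^+ j * enorm v.
  rewrite -mulmxBr -expmx_sub_fixed //; first by apply: HN0; exact: ltnW.
  exact: leq_trans jN.
have [d d0 Hd] := first_order_contraction cC Cxb tP (first_order_iter j SA) AjP eps0.
exists d; split=> // x /Hd h nCx.
(* A zero distance would put [x] in [C]. *)
have xp0 : 0 < enorm (x - projC C x).
  rewrite lt_neqAle enorm_ge0 andbT eq_sym; apply/eqP => /enorm_eq0/eqP.
  rewrite subr_eq0 => /eqP xp; apply: nCx; rewrite xp.
  by have [] := @exists_nearest _ _ C x cC (ex_intro _ xb Cxb).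
by rewrite ler_pdivrMr.
Qed.
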